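(* Given a temporal Heyting algebra $A$, $(\mathrm{Cong}(A),\subseteq) \cong (\mathsf{P}\text{-}\mathrm{Filt}(A),\subseteq) \cong (\mathrm{ClArcUp}(\mathrm{Spec}(A)),\supseteq)$ as posets, via $\theta\mapsto[1]_\theta$, $F\mapsto\{(a,b): a\leftrightarrow b\in F\}$, $F\mapsto\bigcap_{a\in F}\pi a$, and $C\mapsto\bigcap C$.
   Context: Write $\mathsf{P}$ for the ''past diamond'' operator (black diamond). A temporal Heyting algebra is a Heyting algebra with operators $\Box,\mathsf{P}$ such that $\Box(a\wedge b)=\Box a\wedge\Box b$, $a\le\Box a$, $\Box a\le b\vee(b\to a)$, and $\mathsf{P}a\le b\iff a\le\Box b$. $\mathrm{Cong}(A)$ is the set of congruences of $A$. A $\mathsf{P}$-filter is a filter $F$ of $A$ such that $a\to b\in F$ implies $\mathsf{P}a\to\mathsf{P}b\in F$; $\mathsf{P}\text{-}\mathrm{Filt}(A)$ is the set of these. $\mathrm{Spec}(A)$ is the space of prime filters ordered by inclusion, topology generated by $\pi a=\{x: a\in x\}$ and complements, with $xR^{\rhd}y$ iff $\forall a(\Box a\in x\Rightarrow a\in y)$ and $xR^{\lhd}w$ iff $\forall a(a\in w\Rightarrow\mathsf{P}a\in x)$. A subset $S$ of such a space is archival if whenever $x\notin S$, $z\in S$ and $zR^{\lhd}x$, then $R^{\lhd}[z]\cap{\uparrow}x\cap S\neq\varnothing$. $\mathrm{ClArcUp}(X)$ is the set of closed archival upsets of $X$. *)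

(* Defs.v *)
From HB Require Import structures.
From mathcomp Require Import all_boot all_order.
From mathcomp Require Import boolp classical_sets functions topology.

Set Implicit Arguments.
Unset Strict Implicit.
Unset Printing Implicit Defensive.

Local Open Scope classical_set_scope.

HB.mixin Record isHeyting (d : Order.disp_t) A of Order.TBLattice d A := {
  himp : A -> A -> A ;
  himpP : forall a b c : A,
    (a <= himp b c)%O = (Order.meet a b <= c)%O
}.

#[short(type="heytingType")]
HB.structure Definition Heyting (d : Order.disp_t) :=
  {A of isHeyting d A & Order.TBLattice d A}.

HB.mixin Record isTemporalHeyting (d : Order.disp_t) A of Heyting d A := {
  hbox : A -> A ;
  hpast : A -> A ;
  hboxI : forall a b : A, hbox (Order.meet a b) = Order.meet (hbox a) (hbox b) ;
  hbox_ge : forall a : A, (a <= hbox a)%O ;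
  hbox_le : forall a b : A, (hbox a <= Order.join b (himp b a))%O ;
  hpastP : forall a b : A, (hpast a <= b)%O = (a <= hbox b)%O
}.

#[short(type="temporalHeytingType")]
HB.structure Definition TemporalHeyting (d : Order.disp_t) :=
  {A of isTemporalHeyting d A & Heyting d A}.

Definition hiff (d : Order.disp_t) (A : heytingType d) (a b : A) : A :=
  Order.meet (himp a b) (himp b a).

(* [f] and [g] are mutually inverse isomorphisms between the posets
   [(X, leX)] and [(Y, leY)]. *)
Definition poset_iso (S T : Type) (X : set S) (leX : S -> S -> Prop)
    (Y : set T) (leY : T -> T -> Prop) (f : S -> T) (g : T -> S) : Prop :=
  [/\ set_fun X Y f,
      set_fun Y X g,
      forall x, X x -> g (f x) = x,
      forall y, Y y -> f (g y) = y &
      forall x x', X x -> X x' -> (leX x x' <-> leY (f x) (f x'))].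

Section Congruences.
Context (d : Order.disp_t) (A : temporalHeytingType d).

Definition preserves1 (theta : set (A * A)) (f : A -> A) : Prop :=
  forall a b, theta (a, b) -> theta (f a, f b).

Definition preserves2 (theta : set (A * A)) (f : A -> A -> A) : Prop :=
  forall a a' b b',
    theta (a, a') -> theta (b, b') -> theta (f a b, f a' b').

Record congruence (theta : set (A * A)) : Prop := {
  cong_refl : forall a, theta (a, a) ;
  cong_sym : forall a b, theta (a, b) -> theta (b, a) ;
  cong_trans : forall a b c, theta (a, b) -> theta (b, c) -> theta (a, c) ;
  cong_meet : preserves2 theta Order.meet ;
  cong_join : preserves2 theta Order.join ;
  cong_imp : preserves2 theta himp ;
  cong_box : preserves1 theta hbox ;
  cong_past : preserves1 theta hpast
}.

Definition Cong : set (set (A * A)) := [set theta | congruence theta].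

Definition class_of_top (theta : set (A * A)) : set A :=
  [set a | theta (a, Order.top)].

Definition cong_of_filter (F : set A) : set (A * A) :=
  [set ab | F (hiff ab.1 ab.2)].

End Congruences.

Section Filters.
Context (d : Order.disp_t) (A : temporalHeytingType d).

(* The improper filter [setT] is allowed. *)
Record lattice_filter (F : set A) : Prop := {
  lfilter_nonempty : F !=set0 ;
  lfilter_up : forall a b, (a <= b)%O -> F a -> F b ;
  lfilter_meet : forall a b, F a -> F b -> F (Order.meet a b)
}.

Record prime_filter (F : set A) : Prop := {
  prime_lfilter : lattice_filter F ;
  prime_proper : F <> setT ;
  prime_join : forall a b, F (Order.join a b) -> F a \/ F b
}.

Definition past_filter (F : set A) : Prop :=
  lattice_filter F /\
  forall a b, F (himp a b) -> F (himp (hpast a) (hpast b)).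

Definition PFilt : set (set A) := [set F | past_filter F].

End Filters.

Section Spectrum.
Context (d : Order.disp_t) (A : temporalHeytingType d).

Record Spec := MkSpec {
  spec_filter :> set A ;
  spec_prime : prime_filter spec_filter
}.

HB.instance Definition _ := gen_eqMixin Spec.
HB.instance Definition _ := gen_choiceMixin Spec.

Definition spec_pi (a : A) : set Spec := [set x | spec_filter x a].

Definition spec_subbase : set (set Spec) :=
  [set U | exists a, U = spec_pi a \/ U = ~` spec_pi a].

HB.instance Definition _ := isSubBaseTopological.Build Spec spec_subbase id.

Definition spec_le (x y : Spec) : Prop := spec_filter x `<=` spec_filter y.

Definition spec_future (x y : Spec) : Prop :=
  forall a, spec_filter x (hbox a) -> spec_filter y a.

Definition spec_past (x w : Spec) : Prop :=
  forall a, spec_filter w a -> spec_filter x (hpast a).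

Definition upset (S : set Spec) : Prop :=
  forall x y, spec_le x y -> S x -> S y.

Definition archival (S : set Spec) : Prop :=
  forall x z, ~ S x -> S z -> spec_past z x ->
    ([set w | spec_past z w] `&` [set w | spec_le x w] `&` S) !=set0.

Definition ClArcUp : set (set Spec) :=
  [set C | [/\ closed C, archival C & upset C]].

Definition upset_of_filter (F : set A) : set Spec :=
  \bigcap_(a in F) spec_pi a.

Definition filter_of_upset (C : set Spec) : set A :=
  \bigcap_(x in C) spec_filter x.

End Spectrum.

Arguments Cong {d} A _.
Arguments PFilt {d} A _.
Arguments ClArcUp {d} A _.
Arguments Spec {d} A.

(* Main.v *)
Require Import Defs.
From mathcomp Require Import all_boot all_order.
From mathcomp Require Import boolp classical_sets functions topology.

(** A congruence is recovered from the class of [1] because [a] and [b] agree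
    modulo [a <-> b], and the P-filter condition is what makes the relation
    attached to a filter compatible with P; compatibility with the box is
    automatic from [a <= box a].

    On the spectral side everything rests on the prime filter theorem.  For a
    prime filter [z], the elements [a] with [P a] outside [z] form an ideal, so
    past successors of [z] containing a given filter [G] exist as soon as
    [P] maps [G] into [z].  Applied to the filter generated by [x] and a
    P-filter [F], this gives archivality of the upset of [F]; applied to a
    principal filter, it shows that the intersection of a closed archival upset
    is a P-filter.  A point [x] outside a closed upset [C] has a neighbourhood
    [pi a \ pi b] disjoint from [C], so that [a -> b] belongs to the
    intersection of [C] but not to [x]; this avoids compactness. *)

Import Order.Theory.

Set Implicit Arguments.
Unset Strict Implicit.

Local Open Scope classical_set_scope.

(** * Arithmetic of Heyting implication *)

Section HeytingAlgebra.
Context (d : Order.disp_t) (A : heytingType d).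
Implicit Types a b c : A.

Lemma himp_mp a b : (a `&` himp a b <= b)%O.
Proof. by rewrite meetC -himpP. Qed.

Lemma himp_top a b : (a <= b)%O -> himp a b = \top%O.
Proof. by move=> ab; apply/le_anti; rewrite lex1 himpP meet1x ab. Qed.

Lemma himp1x a : himp \top%O a = a.
Proof. by apply/le_anti; rewrite himpP leIl -{1}[himp _ a]meet1x himp_mp. Qed.

Lemma hiffx1 a : hiff a \top%O = a.
Proof. by rewrite /hiff himp_top ?lex1// himp1x meet1x. Qed.

Lemma meet_hiff a b : (a `&` hiff a b = b `&` hiff a b)%O.
Proof.
apply/le_anti/andP; split; rewrite lexI leIr andbT.
  by apply: le_trans (himp_mp a b); rewrite leI2// leIl.
by apply: le_trans (himp_mp b a); rewrite leI2// leIr.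
Qed.

(** The underlying lattice is not declared distributive; distributivity follows because meeting with
    [c] is left adjoint to [himp c]. *)
Lemma heyting_meetUr a b c : (c `&` (a `|` b) <= (c `&` a) `|` (c `&` b))%O.
Proof.
by rewrite meetC -himpP leUx !himpP ![(_ `&` c)%O]meetC leUl leUr.
Qed.

End HeytingAlgebra.

(** * Monotonicity and adjunction for the box and the past diamond *)

Section TemporalOperators.
Context (d : Order.disp_t) (A : temporalHeytingType d).
Implicit Types a b c : A.

Lemma hbox_mono a b : (a <= b)%O -> (hbox a <= hbox b)%O.
Proof. by move=> /meet_l ab; rewrite -ab hboxI leIr. Qed.

Lemma hpast_mono a b : (a <= b)%O -> (hpast a <= hpast b)%O.
Proof. by move=> ab; rewrite hpastP (le_trans ab)// -hpastP. Qed.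

Lemma hpast0 : hpast \bot%O = \bot%O :> A.
Proof. by apply/le_anti; rewrite le0x hpastP le0x. Qed.

Lemma hpastU a b : (hpast (a `|` b) <= hpast a `|` hpast b)%O.
Proof. by rewrite hpastP leUx -!hpastP leUl leUr. Qed.

(** An implication lies below its own box, and the box preserves meets, so modus ponens can be
    carried out under the box. *)
Lemma himp_box a b : (himp a b <= himp (hbox a) (hbox b))%O.
Proof.
rewrite himpP (le_trans (leI2 (hbox_ge _) (lexx _)))// -hboxI hbox_mono//.
by rewrite meetC himp_mp.
Qed.

End TemporalOperators.

(** * Filters, ideals and the prime filter theorem *)

Section LatticeFilters.
Context (d : Order.disp_t) (A : temporalHeytingType d).
Implicit Types (a b c : A) (F G I : set A).

Lemma filter_top F : lattice_filter F -> F \top%O.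
Proof. by case=> [[a Fa] up _]; apply: up Fa; rewrite lex1. Qed.

Lemma filter_himp F a b : lattice_filter F -> F (himp a b) -> F a -> F b.
Proof.
move=> FF Fab Fa; apply: (lfilter_up FF (himp_mp a b)).
exact: lfilter_meet.
Qed.

Lemma principal_filter a : lattice_filter [set b | (a <= b)%O].
Proof.
split; first by exists a => /=.
  by move=> b c bc /= /le_trans; apply.
by move=> b c /= ab ac; rewrite lexI ab.
Qed.

(** When [F] and [G] are filters this is their join, the filter generated by their union. *)
Definition filter_sup F G : set A :=
  [set c | exists f g, [/\ F f, G g & (f `&` g <= c)%O]].

Lemma filter_sup_filter F G :
  lattice_filter F -> lattice_filter G -> lattice_filter (filter_sup F G).
Proof.
move=> FF FG; split.
- exists \top%O; exists \top%O, \top%O.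
  by split; [exact: filter_top|exact: filter_top|rewrite lex1].
- by move=> a b ab [f [g [Ff Gg fga]]]; exists f, g; split=> //; apply: le_trans ab.
- move=> a b [f [g [Ff Gg fga]]] [f' [g' [Ff' Gg' fgb]]].
  exists (f `&` f')%O, (g `&` g')%O; split; [exact: lfilter_meet..|].
  by rewrite meetACA leI2.
Qed.

Lemma filter_supl F G : lattice_filter G -> F `<=` filter_sup F G.
Proof.
by move=> FG a Fa; exists a, \top%O; split=> //; [exact: filter_top|rewrite leIl].
Qed.

Lemma filter_supr F G : lattice_filter F -> G `<=` filter_sup F G.
Proof.
by move=> FF a Ga; exists \top%O, a; split=> //; [exact: filter_top|rewrite leIr].
Qed.

Record lattice_ideal I : Prop := {
  lideal_bot : I \bot%O ;
  lideal_down : forall a b, (a <= b)%O -> I b -> I a ;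
  lideal_join : forall a b, I a -> I b -> I (a `|` b)%O
}.

Lemma principal_ideal b : lattice_ideal [set a | (a <= b)%O].
Proof.
split=> /=; first by rewrite le0x.
  by move=> a c /le_trans; apply.
by move=> a c ab cb; rewrite leUx ab.
Qed.

(** By totality, any two elements of the union already lie in a single filter of the family.
    Adjoining [F] everywhere covers the empty chain, whose union is no filter by itself. *)
Lemma chain_bigcup_filter F (W : set (set A)) :
  lattice_filter F -> (forall X, W X -> lattice_filter (F `|` X)) ->
  total_on W subset -> lattice_filter (F `|` \bigcup_(X in W) X).
Proof.
move=> FF WF Wtot.
have dir a b : (F `|` \bigcup_(X in W) X) a -> (F `|` \bigcup_(X in W) X) b ->
    exists Y, [/\ lattice_filter Y, Y a, Y b & Y `<=` F `|` \bigcup_(X in W) X].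
  have sub X : W X -> F `|` X `<=` F `|` \bigcup_(X in W) X.
    by move=> WX c [?|Xc]; [left|right; exists X].
  move=> [Fa|[X WX Xa]] [Fb|[Y WY Yb]].
  - by exists F; split=> //; left.
  - by exists (F `|` Y); split; [exact: WF|left|right|exact: sub].
  - by exists (F `|` X); split; [exact: WF|right|left|exact: sub].
  - have [XY|YX] := Wtot _ _ WX WY.
      by exists (F `|` Y); split; [exact: WF|right; exact: XY|right|exact: sub].
    by exists (F `|` X); split; [exact: WF|right|right; exact: YX|exact: sub].
split.
- by exists \top%O; left; exact: filter_top.
- by move=> a b ab Ua; have [Y [FY Ya _]] := dir _ _ Ua Ua; apply; exact: lfilter_up Ya.
- by move=> a b Ua Ub; have [Y [FY Ya Yb]] := dir _ _ Ua Ub; apply; exact: lfilter_meet.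
Qed.

(** Zorn's lemma gives a filter [M] maximal among those containing [F] and avoiding [I]; maximality
    and distributivity make it prime. *)
Lemma prime_filter_separation F I :
  lattice_filter F -> lattice_ideal I -> (forall a, F a -> ~ I a) ->
  exists x : Spec A, F `<=` spec_filter x /\ forall a, spec_filter x a -> ~ I a.
Proof.
move=> FF II FI.
pose P X := lattice_filter (F `|` X) /\ forall a, (F `|` X) a -> ~ I a.
have [W WP Wtot|X [[FM MI] Xmax]] := @Zorn_bigcup A P.
  split; first by apply: chain_bigcup_filter => // X /WP[].
  by move=> a [/FI//|[X /WP[_ XI] Xa]]; apply: XI; right.
set M := F `|` X in FM MI.
have ext a : ~ M a -> exists2 m, M m & I (m `&` a)%O.
  move=> Ma; apply: contrapT => noI.
  (* The filter generated by [M] and [a] would still avoid [I] and strictly extend [M]. *)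
  pose N := filter_sup M [set b | (a <= b)%O].
  have MN : M `<=` N by apply: filter_supl; exact: principal_filter.
  have FN : F `|` N = N by apply/setUidPr => c Fc; apply: MN; left.
  apply: (Xmax N).
    split; first by move=> c Xc; apply: MN; right.
    move=> NX; apply: Ma; right; apply: NX.
    by apply: filter_supr => //=.
  rewrite /P FN; split; first exact: filter_sup_filter (principal_filter a).
  move=> c [m [b [Mm /= ab mbc]]] Ic; apply: noI; exists m => //.
  by apply: lideal_down Ic => //; apply: le_trans mbc; rewrite leI2.
have Mprime : prime_filter M.
  split=> //.
    by move=> MT; apply: (MI \bot%O); [rewrite MT|exact: lideal_bot].
  move=> a b Mab; apply: contrapT => /not_orP[/ext[m Mm Ima] /ext[n Mn Inb]].
  (* This element of [M] lies in [I]: by distributivity it is below a join of two elements, one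
     below [m] meet [a], the other below [n] meet [b]. *)
  apply: (MI ((m `&` n) `&` (a `|` b))%O).
    by do 2?[apply: (lfilter_meet FM)].
  apply: (lideal_down II (heyting_meetUr _ _ _)); apply: lideal_join => //.
    by apply: (lideal_down II _ Ima); rewrite leI2// leIl.
  by apply: (lideal_down II _ Inb); rewrite leI2// leIr.
by exists (MkSpec Mprime); split=> //= a Fa; left.
Qed.

End LatticeFilters.

(** * The spectrum: past successors, topology, and filters against closed archival upsets *)

Section PrimeSpectrum.
Context (d : Order.disp_t) (A : temporalHeytingType d).
Implicit Types (a b c : A) (F G : set A) (x y z : Spec A) (C : set (Spec A)).

Lemma spec_lfilter x : lattice_filter (spec_filter x).
Proof. exact: prime_lfilter (spec_prime x). Qed.

Lemma spec_bot x : ~ spec_filter x \bot%O.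
Proof.
move=> x0; apply: (prime_proper (spec_prime x)); apply/seteqP; split=> // a _.
by apply: (lfilter_up (spec_lfilter x) _ x0); rewrite le0x.
Qed.

(** Separate the filter generated by [x] and [a] from the ideal below [b]; by residuation a common
    element would put [himp a b] in [x]. *)
Lemma spec_himp_sep x a b : ~ spec_filter x (himp a b) ->
  exists y, [/\ spec_le x y, spec_filter y a & ~ spec_filter y b].
Proof.
move=> xab; have Fx := spec_lfilter x; have Fa := principal_filter a.
have [|y [xy yb]] := prime_filter_separation (filter_sup_filter Fx Fa)
    (principal_ideal b).
  move=> c [f [g [xf /= ag fgc]]] cb; apply: xab.
  apply: lfilter_up xf => //; rewrite himpP.
  by apply: le_trans cb; apply: le_trans fgc; rewrite leI2.
exists y; split.
- by move=> c xc; apply: xy; exact: filter_supl.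
- by apply: xy; apply: filter_supr => //=.
- by move=> /yb; apply => /=.
Qed.

(** The past diamond, as a left adjoint, preserves finite joins, and [z] is prime. *)
Lemma past_ideal z : lattice_ideal [set a | ~ spec_filter z (hpast a)].
Proof.
have Fz := spec_lfilter z; split=> /=.
- by rewrite hpast0; exact: spec_bot.
- by move=> a b ab zb za; apply: zb; apply: lfilter_up za => //; exact: hpast_mono.
- move=> a b za zb zab.
  by have [] := prime_join (spec_prime z) (lfilter_up Fz (hpastU a b) zab).
Qed.

(** A prime filter avoiding the ideal of [past_ideal] is precisely a past successor of [z]. *)
Lemma past_successor z G : lattice_filter G ->
  (forall a, G a -> spec_filter z (hpast a)) ->
  exists y, spec_past z y /\ G `<=` spec_filter y.
Proof.
move=> FG Gz.
have [|y [Gy yz]] := prime_filter_separation FG (past_ideal z).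
  by move=> a /Gz za; apply.
by exists y; split=> // a /yz /contrapT.
Qed.

Lemma spec_open (U : set (Spec A)) : open U <->
  exists2 D, D `<=` finI_from (@spec_subbase d A) id & \bigcup_(V in D) V = U.
Proof. by []. Qed.

(** A finite intersection of sets [spec_pi a] and complements of sets [spec_pi b] collapses to one
    difference: take the meet of the former indices and the join of the latter. *)
Lemma spec_basis (U : set (Spec A)) x : open U -> U x ->
  exists a b, [/\ spec_filter x a, ~ spec_filter x b &
    spec_pi a `\` spec_pi b `<=` U].
Proof.
move=> /spec_open[D DS <-] [V DV Vx].
suff [a [b [xa xb abV]]] : exists a b, [/\ spec_filter x a, ~ spec_filter x b &
    spec_pi a `\` spec_pi b `<=` V].
  by exists a, b; split=> // y /abV Vy; exists V.
have Fx := spec_lfilter x.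
(* Finite intersections are built in rounds of binary intersections, starting from the subbase and
   the whole space; the induction is on the number of rounds. *)
have {DV} := DS _ DV; rewrite filterI_iter_finI => -[n _].
rewrite image_id.
elim: n V Vx {D DS} => [|n IH] V Vx /=.
  case=> [->|[c [Vc|Vc]]].
  - by exists \top%O, \bot%O; split; [exact: filter_top|exact: spec_bot|].
  - exists c, \bot%O; split; [by rewrite Vc in Vx|exact: spec_bot|].
    by rewrite Vc => y [].
  - exists \top%O, c; split; [exact: filter_top|by rewrite Vc in Vx|].
    by rewrite Vc => y [].
case=> P Pn [Q Qn PQ]; move: Vx; rewrite -PQ => -[Px Qx].
have [a [b [xa xb abP]]] := IH _ Px Pn.
have [a' [b' [xa' xb' abQ]]] := IH _ Qx Qn.
exists (a `&` a')%O, (b `|` b')%O; split.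
- exact: lfilter_meet.
- by move=> /(prime_join (spec_prime x))[].
- move=> y [yaa ybb]; have Fy := spec_lfilter y; split.
    apply: abP; split; first by apply: (lfilter_up Fy _ yaa); rewrite leIl.
    by move=> yb; apply: ybb; apply: (lfilter_up Fy _ yb); rewrite leUl.
  apply: abQ; split; first by apply: (lfilter_up Fy _ yaa); rewrite leIr.
  by move=> yb; apply: ybb; apply: (lfilter_up Fy _ yb); rewrite leUr.
Qed.

Lemma spec_pi_closed a : closed (spec_pi a).
Proof.
rewrite -openC; apply/spec_open; exists [set ~` spec_pi a]; last by rewrite bigcup_set1.
by move=> _ ->; apply: (@finI_from1 _ _ _ id); exists a; right.
Qed.

Lemma upset_himp C a b : upset C ->
  (forall y, C y -> spec_filter y a -> spec_filter y b) ->
  filter_of_upset C (himp a b).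
Proof.
move=> upC Cab x Cx; apply: contrapT => /spec_himp_sep[y [xy ya]].
by apply; apply: Cab => //; exact: upC xy Cx.
Qed.

Lemma filter_of_upset_filter C : lattice_filter (filter_of_upset C).
Proof.
split.
- by exists \top%O => x _; exact: filter_top (spec_lfilter x).
- by move=> a b ab Ca x Cx; exact: (lfilter_up (spec_lfilter x) ab (Ca x Cx)).
- by move=> a b Ca Cb x Cx; apply: (lfilter_meet (spec_lfilter x)); [exact: Ca|exact: Cb].
Qed.

Lemma filter_of_upset_past C :
  archival C -> upset C -> past_filter (filter_of_upset C).
Proof.
move=> arC upC; split; first exact: filter_of_upset_filter.
move=> a b Cab; apply: upset_himp => // z Cz za.
(* The past successor [x] of [z] contains [a] but may fall outside [C]; archivality then replaces it
   by a point of [C] above it that is still a past successor of [z]. *)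
have [c /= ac|x [zx ax]] := @past_successor z _ (principal_filter a).
  by apply: lfilter_up za; [exact: spec_lfilter|exact: hpast_mono].
suff [w [Cw zw wa]] : exists w, [/\ C w, spec_past z w & spec_filter w a].
  by apply: zw; apply: filter_himp (Cab w Cw) wa; exact: spec_lfilter.
have xa : spec_filter x a by apply: ax => /=.
have [Cx|Cx] := pselect (C x); first by exists x.
by have [w [[/= zw xw] Cw]] := arC _ _ Cx Cz zx; exists w; split=> //; exact: xw.
Qed.

Lemma upset_of_filter_ClArcUp F : past_filter F -> ClArcUp A (upset_of_filter F).
Proof.
move=> [FF Fpast]; split.
- by apply: closed_bigI => a _; exact: spec_pi_closed.
- move=> x z _ Fz zx; have Fx := spec_lfilter x.
  (* The required point is a past successor of [z] containing both [x] and [F]. If [c] in [x] and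
     [f] in [F] meet below [a], then [himp c a] is in [F], so [himp (hpast c) (hpast a)] is in [z],
     as is [hpast c]. *)
  have [a [c [f [xc Ff cfa]]]|w [zw xFw]] :=
      @past_successor z _ (filter_sup_filter Fx FF).
    apply: (filter_himp (spec_lfilter z) _ (zx c xc)); apply: Fz; apply: Fpast.
    by apply: lfilter_up Ff => //; rewrite himpP meetC.
  exists w; split; first by split=> //= a xa; apply: xFw; exact: filter_supl.
  by move=> a Fa; apply: xFw; exact: filter_supr.
- by move=> x y xy Fx a Fa; apply: xy; exact: Fx.
Qed.

(** An element outside [F] is omitted by some prime filter containing [F]. *)
Lemma upset_of_filterK F :
  lattice_filter F -> filter_of_upset (upset_of_filter F) = F.
Proof.
move=> FF; apply/seteqP; split=> [a|a Fa x]; last exact.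
apply: contraPP => Fa Ca.
have [b Fb /= ba|x [Fx xa]] := prime_filter_separation FF (principal_ideal a).
  by apply: Fa; exact: lfilter_up Fb.
by apply: (xa a) => //=; exact: Ca.
Qed.

Lemma filter_of_upsetK C :
  closed C -> upset C -> upset_of_filter (filter_of_upset C) = C.
Proof.
move=> clC upC; apply/seteqP; split=> [x Cx|x Cx a]; last exact.
apply: contrapT => nCx; move: clC; rewrite -openC => oC.
have [a [b [xa xb abC]]] := spec_basis oC nCx.
apply: xb; apply: filter_himp xa; first exact: spec_lfilter.
apply: Cx; apply: upset_himp => // y Cy ya; apply: contrapT => yb.
exact: (abC y).
Qed.

End PrimeSpectrum.

(** * Congruences against P-filters *)

Section CongruencesAndFilters.
Context (d : Order.disp_t) (A : temporalHeytingType d).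
Implicit Types (a b c : A) (F : set A) (theta : set (A * A)).

Lemma cong_hiff theta a b : congruence theta ->
  theta (hiff a b, \top%O) <-> theta (a, b).
Proof.
move=> ct; have crefl := cong_refl ct; split=> [ab1|ab].
  (* Meeting with an element congruent to the top changes nothing modulo [theta], and [a] and [b]
     have the same meet with [hiff a b]. *)
  have eq1 c : theta (c, c `&` hiff a b)%O.
    by apply: (cong_sym ct); have := cong_meet ct (crefl c) ab1; rewrite meetx1.
  by apply: (cong_trans ct) (eq1 a) _; rewrite meet_hiff; exact: cong_sym (eq1 b).
have /(cong_trans ct) : theta (hiff a b, hiff b b).
  by apply: (cong_meet ct); apply: (cong_imp ct).
by apply; rewrite /hiff himp_top// meetxx; exact: crefl.
Qed.

Lemma class_of_top_past theta : congruence theta -> past_filter (class_of_top theta).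
Proof.
move=> ct; have crefl := cong_refl ct; split; first split.
- by exists \top%O; exact: crefl.
- move=> a b ab /= a1; have := cong_join ct a1 (crefl b).
  by rewrite (join_r ab) join1x.
- by move=> a b /= a1 b1; have := cong_meet ct a1 b1; rewrite meetxx.
move=> a b /= ab1.
(* Modulo [theta], [a] may be replaced by its meet with [b], for which the implication between past
   diamonds is the top by monotonicity. *)
have aab : theta (a, a `&` b)%O.
  apply: (cong_sym ct); have := cong_meet ct (crefl a) ab1; rewrite meetx1.
  suff -> : (a `&` himp a b = a `&` b)%O by [].
  by apply/le_anti; rewrite !lexI !leIl himp_mp/= himpP -meetA leIxr// leIl.
have := cong_imp ct (cong_past ct aab) (crefl (hpast b)).
by rewrite [himp (hpast (_ `&` _)%O) _]himp_top// hpast_mono// leIr.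
Qed.

Lemma cong_of_filter_cong F : past_filter F -> congruence (cong_of_filter F).
Proof.
move=> [FF Fpast].
have FE a b : cong_of_filter F (a, b) <-> F (himp a b) /\ F (himp b a).
  split=> [/= Fab|[Fab Fba]]; last exact: lfilter_meet.
  by split; apply: lfilter_up Fab => //; [exact: leIl|exact: leIr].
have Fimp a b c : (a `&` b <= c)%O -> F a -> F (himp b c).
  by move=> abc; apply: lfilter_up => //; rewrite himpP.
(* The hypotheses are symmetric in the two pairs, so compatibility reduces to a single
   implication. *)
have P2 (f : A -> A -> A) :
    (forall a a' b b', F (himp a a') -> F (himp a' a) -> F (himp b b') ->
      F (himp b' b) -> F (himp (f a b) (f a' b'))) ->
    preserves2 (cong_of_filter F) f.
  by move=> Ff a a' b b' /FE[? ?] /FE[? ?]; apply/FE; split; exact: Ff.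
have P1 (f : A -> A) :
    (forall a b, F (himp a b) -> F (himp (f a) (f b))) ->
    preserves1 (cong_of_filter F) f.
  by move=> Ff a b /FE[? ?]; apply/FE; split; exact: Ff.
split.
- by move=> a; apply/FE; rewrite himp_top//; split; exact: filter_top.
- by move=> a b /FE[? ?]; apply/FE.
- have tr a b c : F (himp a b) -> F (himp b c) -> F (himp a c).
    move=> Fab Fbc; apply: Fimp (lfilter_meet FF Fab Fbc).
    rewrite meetC meetA; apply: le_trans (himp_mp b c).
    by rewrite leI2// himp_mp.
  by move=> a b c /FE[? ?] /FE[? ?]; apply/FE; split; apply: tr; eassumption.
- apply: P2 => a a' b b' Fa _ Fb _; apply: Fimp (lfilter_meet FF Fa Fb).
  by rewrite meetACA leI2// meetC himp_mp.
- apply: P2 => a a' b b' Fa _ Fb _; apply: Fimp (lfilter_meet FF Fa Fb).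
  apply: le_trans (heyting_meetUr _ _ _) _; rewrite leU2//.
    by apply: le_trans (himp_mp a a'); rewrite meetC leI2// leIl.
  by apply: le_trans (himp_mp b b'); rewrite meetC leI2// leIr.
(* Implication is contravariant in its first argument, so [himp a' a] is used here together with
   [himp b b']. *)
- apply: P2 => a a' b b' _ Fa Fb _; apply: Fimp (lfilter_meet FF Fa Fb).
  rewrite himpP; apply: le_trans (himp_mp b b').
  rewrite lexI; apply/andP; split; last by rewrite -!meetA leIxr// leIxl.
  apply: le_trans (himp_mp a b); rewrite lexI; apply/andP; split.
    apply: le_trans (himp_mp a' a).
    by rewrite lexI leIr/= -!meetA leIxl.
  by rewrite leIxl// leIr.
- by apply: P1 => a b; apply: lfilter_up => //; exact: himp_box.
- exact: P1.
Qed.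

Lemma class_of_topK theta :
  congruence theta -> cong_of_filter (class_of_top theta) = theta.
Proof.
by move=> ct; apply/seteqP; split=> -[a b] /= /(cong_hiff a b ct).
Qed.

Lemma cong_of_filterK F : class_of_top (cong_of_filter F) = F.
Proof. by apply/seteqP; split=> a; rewrite /class_of_top /cong_of_filter /= hiffx1. Qed.

End CongruencesAndFilters.

(** * Assembly of the two isomorphisms *)

(** Monotonicity of the inverse [g] gives order reflection for [f]. *)
Lemma poset_isoI (S T : Type) (X : set S) (leX : S -> S -> Prop)
    (Y : set T) (leY : T -> T -> Prop) (f : S -> T) (g : T -> S) :
  set_fun X Y f -> set_fun Y X g ->
  (forall x, X x -> g (f x) = x) -> (forall y, Y y -> f (g y) = y) ->
  (forall x x', leX x x' -> leY (f x) (f x')) ->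
  (forall y y', leY y y' -> leX (g y) (g y')) ->
  poset_iso X leX Y leY f g.
Proof.
move=> fXY gYX gf fg fmono gmono; split=> // x x' Xx Xx'; split; first exact: fmono.
by move=> /gmono; rewrite !gf.
Qed.

Theorem theorem3p15 (d : Order.disp_t) (A : temporalHeytingType d) :
  poset_iso (Cong A) (fun theta theta' => theta `<=` theta')
            (PFilt A) (fun F F' => F `<=` F')
            (@class_of_top d A) (@cong_of_filter d A)
  /\
  poset_iso (PFilt A) (fun F F' => F `<=` F')
            (ClArcUp A) (fun C C' => C' `<=` C)
            (@upset_of_filter d A) (@filter_of_upset d A).
Proof.
split; apply: poset_isoI.
- exact: class_of_top_past.
- exact: cong_of_filter_cong.
- exact: class_of_topK.
- by move=> F _; exact: cong_of_filterK.
- by move=> theta theta' sub a; exact: sub.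
- by move=> F F' sub [a b]; exact: sub.
- exact: upset_of_filter_ClArcUp.
- by move=> C [_ arC upC]; exact: filter_of_upset_past.
- by move=> F [FF _]; exact: upset_of_filterK.
- by move=> C [clC _ upC]; exact: filter_of_upsetK.
- by move=> F F' sub x F'x a Fa; apply: F'x; exact: sub.
- by move=> C C' sub a Ca x C'x; apply: Ca; exact: sub.
Qed.
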